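(* Let $n\ge 2$ be an even integer. Among all binary trees $T$ with $n$ vertices, $$ \min_T \left( \min_{v \in Core(T),\ w\in L(T)} \frac{F_T(v)}{F_T(w)} \right) = \begin{cases} \dfrac{ 9\cdot2^{\frac{n-4}{2}}-3\cdot2^{\frac{n}{4}}+1 }{9\cdot2^{\frac{n-6}{2}}-3\cdot2^{\frac{n-4}{4}}+1}, & n\equiv0\pmod 4,\\[10pt] \dfrac{ 9\cdot2^{\frac{n-4}{2}}-3\cdot2^{\frac{n-2}{4}}-3\cdot2^{\frac{n-6}{4}}+1 }{9\cdot2^{\frac{n-6}{2}}-3\cdot2^{\frac{n-6}{4}}-3\cdot2^{\frac{n-10}{4}}+1}, & n\equiv2\pmod 4, \end{cases} $$ and this minimum is attained when $T$ is a binary caterpillar, $v$ is a subtree core vertex of $T$ (located in the middle) and $w$ is a leaf adjacent to $v$.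
   Context: A binary tree is a tree in which every non-leaf vertex has degree $3$ (such trees have an even number of vertices). A binary caterpillar is a binary tree whose non-leaf vertices induce a path. $L(T)$ is the set of leaves of $T$. $F_T(z)$ is the number of subtrees of $T$ containing the vertex $z$, and the subtree core $Core(T)$ is the set of vertices maximizing $F_T(\cdot)$. *)

(* Defs.v *)
From mathcomp Require Import all_boot all_order all_algebra.
From mathcomp Require Import boolp.

Set Implicit Arguments.
Unset Strict Implicit.
Unset Printing Implicit Defensive.

Import Order.TTheory GRing.Theory Num.Theory.
Local Open Scope ring_scope.

Section Trees.
Variable T : finType.
Implicit Types (e : rel T) (V : {set T}) (E : {set {set T}}).

(* A cycle of a simple graph has at least 3 vertices; [:: x] is an e-cycle only
   if e x x, and [:: x; y] just runs back and forth along one edge. *)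
Definition acyclic e : Prop :=
  forall p : seq T, ucycle e p -> (size p <= 2)%N.

(* The simple graph with vertex set V and adjacency relation e is a tree. *)
Definition is_tree V e : Prop :=
  [/\ V != set0,
      symmetric e /\ irreflexive e,
      forall x y, e x y -> x \in V /\ y \in V,
      {in V &, forall x y, connect e x y}
    & acyclic e].

Definition deg e (x : T) : nat := #|[set y | e x y]|.

Definition leaves e : {set T} := [set x | deg e x == 1%N].

Definition binary_tree e : Prop :=
  is_tree [set: T] e /\ forall x, x \notin leaves e -> deg e x = 3.

(* s lists the non-leaf vertices in such a way that two of them are adjacent
   iff they are consecutive.  The path s may be empty: the one-edge tree is
   (degenerately) a binary caterpillar. *)
Definition binary_caterpillar e : Prop :=
  binary_tree e /\
  exists s : seq T,
    [/\ uniq s,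
        forall x, (x \in s) = (x \notin leaves e)
      & {in s &, forall x y, e x y =
           (index y s == (index x s).+1) || (index x s == (index y s).+1)}].

Definition edge_rel E : rel T := fun x y => [set x; y] \in E.

(* The subgraph of e with vertex set H.1 and edge set H.2 is a tree; an edge is
   the set of its two endpoints. *)
Definition subtree e (H : {set T} * {set {set T}}) : Prop :=
  (forall A, A \in H.2 -> exists x y, e x y /\ A = [set x; y]) /\
  is_tree H.1 (edge_rel H.2).

Definition nsubtrees e (z : T) : nat :=
  #|[set H : {set T} * {set {set T}} | `[< subtree e H >] && (z \in H.1)]|.

Definition core e : {set T} :=
  [set v | [forall u, nsubtrees e u <= nsubtrees e v]%N].

Definition subtree_ratio e (v w : T) : rat := (nsubtrees e v)%:R / (nsubtrees e w)%:R.

Definition core_leaf_ratio e (q : rat) : Prop :=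
  exists v w, [/\ v \in core e, w \in leaves e & q = subtree_ratio e v w].

Definition simple_path e (p : seq T) : bool := uniq p && sorted e p.

(* v is a middle vertex (one of the two if the number of vertices is even) of
   a longest path. *)
Definition in_middle e (v : T) : Prop :=
  exists p : seq T,
    [/\ simple_path e p,
        forall p', simple_path e p' -> (size p' <= size p)%N,
        v \in p
      & (index v p == (size p)./2) || (index v p == (size p).-1./2)].

End Trees.

Definition is_min (S : rat -> Prop) (m : rat) : Prop :=
  S m /\ forall q, S q -> m <= q.

(* 2 ^ ((n - a) / d) with an integer exponent, negative for small n; all the
   divisions below are exact. *)
Definition pow2 (n a d : nat) : rat := 2 ^ (((n%:Z - a%:Z) %/ d%:Z)%Z).

Definition min_ratio (n : nat) : rat :=
  if (n %% 4 == 0)%N then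
    (9 * pow2 n 4 2 - 3 * pow2 n 0 4 + 1)
    / (9 * pow2 n 6 2 - 3 * pow2 n 4 4 + 1)
  else
    (9 * pow2 n 4 2 - 3 * pow2 n 2 4 - 3 * pow2 n 6 4 + 1)
    / (9 * pow2 n 6 2 - 3 * pow2 n 6 4 - 3 * pow2 n 10 4 + 1).

(* Main.v *)
Require Import Defs.
From mathcomp Require Import all_boot all_order all_algebra.
From mathcomp Require Import boolp zify ring lra.

(* Write [F] for [nsubtrees e].  A leaf [w] with neighbour [u] satisfies
   [2 F w = F u + 2], so for a core vertex [v] the ratio [F v / F w] is at least
   [2 F v / (F v + 2)], with equality when [w] is adjacent to [v].  This bound
   increases with [F v], hence everything reduces to minimizing [max F] over the
   binary trees with [n] vertices.

   In a tree the subtrees are the connected vertex sets, and these multiply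
   across bridges: [F y] is the product, over the neighbours [u] of [y], of
   [1 +] the number of subtrees rooted at [u] in the branch of [u].  By induction
   a branch with [2 k + 1] vertices has weight at least [3 * 2 ^ k - 1], with
   equality for caterpillars.  At a centroid the three branches have
   [k1 + k2 + k3 = (n - 4) / 2] with all [ki] at most half the total, rounded up,
   and log-concavity of [k |-> 3 * 2 ^ k - 1] pushes the product down to the
   extreme triple, which is realized by the middle of a caterpillar. *)

Set Implicit Arguments.
Unset Strict Implicit.
Unset Printing Implicit Defensive.

(** * Unordered pairs and propagation along connectivity *)

Lemma set2_eq (T : finType) (a b x y : T) :
  [set a; b] = [set x; y] -> (a = x /\ b = y) \/ (a = y /\ b = x).
Proof.
move=> E.
have : a \in [set x; y] by rewrite -E set21.
have : b \in [set x; y] by rewrite -E set22.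
have : x \in [set a; b] by rewrite E set21.
have : y \in [set a; b] by rewrite E set22.
by rewrite !inE => /orP[]/eqP-> /orP[]/eqP-> /orP[]/eqP h1 /orP[]/eqP h2; subst; auto.
Qed.

Lemma connect_ind (T : finType) (r : rel T) (P : T -> Prop) x :
  P x -> (forall a b, P a -> r a b -> P b) -> forall y, connect r x y -> P y.
Proof.
move=> Px Pr y /connectP[p pth ->].
elim: p x Px pth => [//|a p IH] x Px /= /andP[rxa pth].
exact: IH (Pr _ _ Px rxa) pth.
Qed.

Lemma connect_homo (T : finType) (r r' : rel T) (f : T -> T) :
  (forall a b, r a b -> connect r' (f a) (f b)) ->
  forall x y, connect r x y -> connect r' (f x) (f y).
Proof.
move=> rr' x; apply: connect_ind => // a b xa /rr'; exact: connect_trans xa.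
Qed.

(** * Counting connected vertex sets through a given vertex *)

Section ConnectedSets.
Variables (T : finType) (e : rel T).
Implicit Types (A B S : {set T}) (x y : T).

Definition induced S : rel T := [rel a b | [&& a \in S, b \in S & e a b]].

Definition connected_from x S : bool :=
  (x \in S) && [forall y in S, connect (induced S) x y].

Definition nconn A x : nat := #|[set S in powerset A | connected_from x S]|.

Lemma connected_fromP x S :
  reflect (x \in S /\ forall y, y \in S -> connect (induced S) x y)
          (connected_from x S).
Proof.
apply: (iffP andP) => -[xS H]; split=> //; first exact/forall_inP.
exact/forall_inP.
Qed.

Lemma connect_inducedS A B x y :
  A \subset B -> connect (induced A) x y -> connect (induced B) x y.
Proof.
move=> /subsetP AB; apply: connect_sub => a b /and3P[aA bA eab].
by apply: connect1; rewrite /induced /= !AB.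
Qed.

Lemma nconn1 x : nconn [set x] x = 1.
Proof.
rewrite /nconn (_ : [set _ in _ | _] = [set [set x]]) ?cards1 //.
apply/setP=> S; rewrite !inE subset1.
apply/idP/eqP => [/andP[/orP[/eqP//|/eqP->]]|->].
  by case/connected_fromP; rewrite inE.
rewrite eqxx /=; apply/connected_fromP; split; first exact: set11.
by move=> y /set1P->.
Qed.

(** Inside [S], the set [A] can be left or entered only at the gate [g], so collapsing everything
    outside [A] onto [g] turns a walk in [S] into a walk in [S :&: A]. This restricts connectivity
    to one side of a bridge. *)
Lemma connect_retract A S g :
    {in S & S, forall a b, a \in A -> b \notin A -> e a b -> a = g} ->
    {in S & S, forall a b, a \in A -> b \notin A -> e b a -> a = g} ->
  let r z := if z \in A then z else g in
  forall x y, connect (induced S) x y -> connect (induced (S :&: A)) (r x) (r y).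
Proof.
move=> Ag Ag' r; apply: connect_homo => a b /and3P[aS bS eab].
rewrite /r; case: ifPn => aA; case: ifPn => bA //.
- by apply: connect1; rewrite /induced /= !inE aS bS aA bA.
- by rewrite (Ag a b).
- by rewrite (Ag' b a).
Qed.

Hypothesis e_sym : symmetric e.

(** A connected set through [x] leaves on [A] a trace connected from [x], and on [B] a trace that is
    empty or connected from [y]; conversely, any two such traces are joined by the edge [x y]. The
    successor counts the empty trace. *)
Lemma nconn_glue A B x y :
    [disjoint A & B] -> x \in A -> y \in B -> e x y ->
    (forall a b, a \in A -> b \in B -> e a b -> a = x /\ b = y) ->
  nconn (A :|: B) x = nconn A x * (nconn B y).+1.
Proof.
move=> dAB xA yB exy only_xy.
pose NA := [set S in powerset A | connected_from x S].
pose NB := [set S in powerset B | connected_from y S].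
pose g (PQ : {set T} * {set T}) := PQ.1 :|: PQ.2.
have NB0 : set0 \notin NB.
  by rewrite !inE; apply/nandP; right; apply/connected_fromP; rewrite inE => -[].
have -> : nconn A x * (nconn B y).+1 = #|setX NA (set0 |: NB)|.
  by rewrite cardsX cardsU1 NB0.
have inNB Q : Q \in set0 |: NB -> Q \subset B.
  by rewrite !inE => /orP[/eqP->|/andP[]//]; exact: sub0set.
have dsj z : z \in A -> z \in B -> False.
  by move=> zA zB; move/pred0P/(_ z): dAB; rewrite /= zA zB.
have gA (P Q : {set T}) : P \subset A -> Q \subset B -> (P :|: Q) :&: A = P.
  move=> /subsetP PA /subsetP QB; apply/setP=> z; rewrite !inE.
  apply/andP/idP => [[/orP[//|/QB zB] zA]|zP]; first by case: (dsj z).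
  by rewrite zP PA.
have gB (P Q : {set T}) : P \subset A -> Q \subset B -> (P :|: Q) :&: B = Q.
  move=> /subsetP PA /subsetP QB; apply/setP=> z; rewrite !inE.
  apply/andP/idP => [[/orP[/PA zA|//] zB]|zP]; first by case: (dsj z).
  by rewrite zP orbT QB.
have ginj : {in setX NA (set0 |: NB) &, injective g}.
  move=> [P Q] [P' Q'] /setXP[/= hP /inNB hQ] /setXP[/= hP' /inNB hQ'].
  move: hP hP'; rewrite !inE => /andP[hP _] /andP[hP' _]; rewrite /g /= => E.
  by congr (_, _); [rewrite -(gA P Q) // E gA|rewrite -(gB P Q) // E gB].
rewrite -(card_in_imset ginj) /nconn; apply: eq_card => S.
apply/idP/imsetP => [|[[P Q] /setXP[/= hP hQ] ->]].
  rewrite !inE => /andP[SAB /connected_fromP[xS Sconn]].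
  exists (S :&: A, S :&: B); last by rewrite /g /= -setIUr; apply/esym/setIidPl.
  apply/setXP; split; rewrite /= !inE.
    rewrite subsetIr; apply/connected_fromP; split; first by rewrite inE xS.
    move=> z /setIP[zS zA].
    have inB b : b \in S -> b \notin A -> b \in B.
      by move=> /(subsetP SAB); rewrite inE => /orP[->|].
    have := @connect_retract A S x _ _ _ _ (Sconn _ zS).
    rewrite xA zA; apply=> a b aS bS aA /(inB _ bS) bB; last rewrite e_sym.
      by case/(only_xy a b).
    by case/(only_xy a b).
  case: (set_0Vmem (S :&: B)) => [->|[z0 z0SB]]; first by rewrite eqxx.
  apply/orP; right; rewrite subsetIr; apply/connected_fromP.
  have H z : z \in S :&: B -> connect (induced (S :&: B)) y z.
    case/setIP=> zS zB.
    have inA b : b \in S -> b \notin B -> b \in A.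
      by move=> /(subsetP SAB); rewrite inE => /orP[|->].
    (* Seen from [B] the gate is [y]: the walk from [x] collapses to a walk from [y]. *)
    have := @connect_retract B S y _ _ _ _ (Sconn _ zS).
    rewrite zB; case: ifPn => [/(dsj x xA)//|_]; apply=> a b aS bS aB /(inA _ bS) bA.
      by rewrite e_sym => /(only_xy b a)[].
    by case/(only_xy b a).
  (* An empty walk does not place its origin in the set, so [y] is located through [z0]: either [z0]
     is [y], or the first edge of the walk leaves [y] inside the set. *)
  split=> //; have /connectP[[|a p] /= pth zl] := H _ z0SB; first by rewrite -zl.
  by case/andP: pth => /and3P[].
move: hP; rewrite !inE => /andP[PA /connected_fromP[xP Pconn]].
have PS : P \subset P :|: Q by exact: subsetUl.
rewrite setUSS ?inNB //=; apply/connected_fromP; split; first by rewrite inE xP.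
move=> z /setUP[/Pconn|zQ]; first exact: connect_inducedS.
move: hQ; rewrite !inE => /orP[/eqP Q0|/andP[QB /connected_fromP[yQ Qconn]]].
  by rewrite Q0 inE in zQ.
apply: (@connect_trans _ _ y).
  by apply: connect1; rewrite /induced /= !inE xP yQ exy orbT.
exact: connect_inducedS (subsetUr _ _) (Qconn _ zQ).
Qed.
End ConnectedSets.

(** * Subtrees of a tree as connected vertex sets *)

Section Tree.
Variables (T : finType) (e : rel T).
Hypothesis e_tree : is_tree [set: T] e.
Implicit Types (S : {set T}) (x y : T).

Let e_sym : symmetric e. Proof. by case: e_tree => _ []. Qed.
Let e_irr : irreflexive e. Proof. by case: e_tree => _ []. Qed.
Let e_conn x y : connect e x y.
Proof. by case: e_tree => _ _ _ + _; apply; rewrite inE. Qed.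
Let e_acyclic : acyclic e. Proof. by case: e_tree. Qed.

(** A simple [r]-path from [x] to [y] closes up with the edge into an [e]-cycle; acyclicity leaves
    it at most two vertices, so the path is that edge. In particular every edge of a tree is a
    bridge. *)
Lemma tree_edge_sub (r : rel T) x y :
  subrel r e -> e x y -> connect r x y -> r x y.
Proof.
move=> re exy /connectP[p pth yl].
have [p' [pth' up' yl']] : exists p', [/\ path r x p', uniq (x :: p') & y = last x p'].
  by rewrite yl; have [p' pth' up' _] := shortenP pth; exists p'.
have : size (x :: p') <= 2.
  apply: e_acyclic; rewrite /ucycle /ucycleb up' andbT /= rcons_path -yl' e_sym exy.
  by rewrite (sub_path re pth').
case: p' pth' yl' {up'} => [|a [|b p']] //= => [_ yx|/andP[rxa _] -> //].
by move: exy; rewrite yx e_irr.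
Qed.

Definition induced_edges S : {set {set T}} :=
  [set A | [exists x, exists y, induced e S x y && (A == [set x; y])]].

Lemma edge_rel_induced S x y : edge_rel (induced_edges S) x y = induced e S x y.
Proof.
rewrite /edge_rel inE; apply/existsP/idP => [[a /existsP[b /andP[H /eqP E]]]|H].
  have [[-> ->]//|[-> ->]] := set2_eq E.
  by case/and3P: H => aS bS eab; rewrite /induced /= aS bS e_sym.
by exists x; apply/existsP; exists y; rewrite H eqxx.
Qed.

(** An edge of [e] between two vertices of the subtree belongs to it, because the subtree already
    connects its ends and [tree_edge_sub] applies. Subtrees are therefore determined by their vertex
    sets. *)
Lemma subtree_edges H : subtree e H -> H.2 = induced_edges H.1.
Proof.
case: H => V E [/= Ee [_ [Esym _] EV Econn _]].
have subE : subrel (edge_rel E) e.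
  move=> x y /Ee[a [b [eab /set2_eq[[-> ->]//|[-> ->]]]]]; by rewrite e_sym.
apply/setP=> A; rewrite inE; apply/idP/existsP => [AE|[x /existsP[y /andP[]]]].
  have [x [y [exy EA]]] := Ee _ AE; exists x; apply/existsP; exists y.
  rewrite EA eqxx andbT; have [xV yV] : x \in V /\ y \in V.
    by apply: EV; rewrite /edge_rel -EA.
  by rewrite /induced /= xV yV.
case/and3P=> xV yV exy /eqP->; apply: (tree_edge_sub subE exy).
exact: Econn.
Qed.

Lemma subtree_induced z S :
  connected_from e z S -> subtree e (S, induced_edges S).
Proof.
case/connected_fromP=> zS Sconn; split=> /= [A|].
  rewrite inE => /existsP[x /existsP[y /andP[/and3P[_ _ exy] /eqP->]]].
  by exists x, y.
have symS : symmetric (induced e S) by move=> a b; rewrite /induced /= e_sym andbCA.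
have ER := edge_rel_induced S.
split.
- by apply/set0Pn; exists z.
- split; first by move=> a b; rewrite !ER symS.
  by move=> a; rewrite ER /induced /= e_irr !andbF.
- by move=> a b; rewrite ER => /and3P[].
- move=> a b aS bS; rewrite (eq_connect ER); apply: (@connect_trans _ _ z).
    by rewrite (sym_connect_sym symS) Sconn.
  exact: Sconn.
- move=> p /andP[cyc up]; apply: e_acyclic; rewrite /ucycle /ucycleb up andbT.
  by apply: sub_cycle cyc => a b; rewrite ER => /and3P[].
Qed.

Lemma nsubtrees_nconn z : nsubtrees e z = nconn e [set: T] z.
Proof.
rewrite /nsubtrees /nconn -[RHS](card_in_imset (f := fun S => (S, induced_edges S))).
  apply: eq_card => H; apply/idP/imsetP => [|[S + ->]].
    rewrite inE => /andP[/asboolP sH zH]; exists H.1; last first.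
      by rewrite -(subtree_edges sH); case: (H).
    rewrite !inE subsetT; apply/connected_fromP; split=> // y yH.
    case: (sH) => _ [_ _ _ + _] => /(_ z y zH yH).
    by rewrite (subtree_edges sH) (eq_connect (edge_rel_induced _)).
  rewrite !inE /= => /andP[_ zS]; case/connected_fromP: (zS) => -> _.
  by rewrite andbT; apply/asboolP/subtree_induced/zS.
by move=> S S' _ _ [].
Qed.

(** * The two sides of an edge *)

Definition cut x y : rel T := [rel a b | e a b && ([set a; b] != [set x; y])].

(** For an edge [x y], the component of [y] once that edge is deleted; the first argument plays the
    part of the parent. *)
Definition branch x y : {set T} := [set z | connect (cut x y) y z].

Lemma cutC x y : cut x y =2 cut y x.
Proof. by move=> a b; rewrite /cut /= (setUC [set x]). Qed.

Lemma cut_sym x y : symmetric (cut x y).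
Proof. by move=> a b; rewrite /cut /= e_sym (setUC [set a]). Qed.

Lemma branch_root x y : y \in branch x y.
Proof. by rewrite inE. Qed.

Lemma branch_step x y a b :
  a \in branch x y -> e a b -> [set a; b] != [set x; y] -> b \in branch x y.
Proof.
rewrite !inE => ya eab ne; apply: connect_trans ya _.
by apply: connect1; rewrite /cut /= eab.
Qed.

(** A common vertex would connect [x] to [y] in [cut x y], and [tree_edge_sub] would then find the
    deleted edge in it. *)
Lemma branch_disj x y z : e x y -> z \in branch x y -> z \in branch y x -> False.
Proof.
move=> exy; rewrite !inE => yz xz.
have : connect (cut x y) x y.
  rewrite -(eq_connect (cutC x y)) in xz; apply: connect_trans xz _.
  by rewrite (sym_connect_sym (@cut_sym x y)).
move/(tree_edge_sub (fun a b H => proj1 (andP H)) exy).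
by rewrite /cut /= eqxx andbF.
Qed.

Lemma branch_cover x y z : e x y -> z \notin branch y x -> z \in branch x y.
Proof.
move=> exy; apply: contraNT => zn.
have : (z \in branch x y) || (z \in branch y x).
  apply: (connect_ind (P := fun z => (z \in branch x y) || (z \in branch y x))) (e_conn x z).
    by rewrite branch_root orbT.
  move=> a b H eab; have [E|ne] := eqVneq [set a; b] [set x; y].
    by have [[_ ->]|[_ ->]] := set2_eq E; rewrite branch_root ?orbT.
  have ne' : [set a; b] != [set y; x] by rewrite (setUC [set y]).
  by case/orP: H => H; rewrite (branch_step H eab) ?orbT.
by rewrite (negbTE zn).
Qed.

Lemma branchC x y : e x y -> branch y x = ~: branch x y.
Proof.
move=> exy; apply/setP=> z; rewrite in_setC; apply/idP/idP => [zx|]; last first.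
  by apply: branch_cover; rewrite e_sym.
by apply/negP=> /(branch_disj exy)/(_ zx).
Qed.

Lemma branch_notin x y : e x y -> x \notin branch x y.
Proof. by move=> exy; apply/negP=> /(branch_disj exy); apply; exact: branch_root. Qed.

Lemma branch_edge x y a b :
  e x y -> a \in branch x y -> b \notin branch x y -> e a b -> a = y /\ b = x.
Proof.
move=> exy aB bB eab; have [E|ne] := eqVneq [set a; b] [set x; y].
  have [[_ bE]|//] := set2_eq E; by move: bB; rewrite bE branch_root.
by rewrite (branch_step aB eab ne) in bB.
Qed.

Lemma branch_sub y u v : e y u -> e y v -> u != v -> branch y v \subset branch u y.
Proof.
move=> eyu eyv uv; apply/subsetP => z; rewrite inE => vz.
have vB : v \in branch u y.
  apply: (branch_step (branch_root u y) eyv); apply: contraNneq uv => /set2_eq[[<- ->]|[_ ->]] //.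
(* The second conjunct strengthens the induction: a walk that stays in [branch y v] avoids [y],
   hence never crosses the edge [u y]. *)
suff /andP[] : (z \in branch u y) && (z \in branch y v) by [].
apply: (connect_ind (P := fun z => (z \in branch u y) && (z \in branch y v))) vz.
  by rewrite vB branch_root.
move=> a b /andP[aU aV] /andP[eab ne]; have bV := branch_step aV eab ne.
rewrite bV andbT (branch_step aU eab) //; apply: contraTneq bV => /set2_eq[[_ ->]|[ay _]].
  exact: branch_notin.
by move: aV; rewrite ay (negbTE (branch_notin eyv)).
Qed.

Lemma branch_disjoint y u v : e y u -> e y v -> u != v -> [disjoint branch y u & branch y v].
Proof.
move=> eyu eyv uv; 
have := branch_sub eyu eyv uv; rewrite (branchC eyu).
by rewrite -disjoints_subset disjoint_sym.
Qed.

Lemma branch_all y z : z != y -> exists2 u, e y u & z \in branch y u.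
Proof.
suff: z = y \/ (exists2 u, e y u & z \in branch y u) by case=> [->|//]; rewrite eqxx.
apply: (connect_ind (P := fun z => z = y \/ exists2 u, e y u & z \in branch y u)) (e_conn y z).
  by left.
move=> a b [->|[u eyu aB]] eab; first by right; exists b => //; exact: branch_root.
have [E|ne] := eqVneq [set a; b] [set y; u]; last by right; exists u => //; exact: branch_step ne.
have [[_ ->]|[_ ->]] := set2_eq E; last by left.
by right; exists u => //; exact: branch_root.
Qed.

(* The successor stands for the empty choice: a subtree may avoid the branch. *)
Definition weight x y : nat := (nconn e (branch x y) y).+1.

(** * Product and sum formulas over the branches at a vertex *)

Definition star y (us : seq T) : {set T} := y |: \bigcup_(u <- us) branch y u.

Lemma star_cons y u us : star y (u :: us) = star y us :|: branch y u.
Proof. by rewrite /star big_cons setUCA setUC. Qed.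

Lemma star_root y us : y \in star y us.
Proof. exact: setU11. Qed.

Lemma starP y us z :
  reflect (z = y \/ exists2 u, u \in us & z \in branch y u) (z \in star y us).
Proof.
elim: us => [|u us IH].
  rewrite /star big_nil setU0; apply: (iffP set1P) => [|[//|[]//]]; by left.
rewrite star_cons; apply: (iffP setUP) => [[/IH[|[v vs zv]]|zu]|[->|[v]]].
- by left.
- by right; exists v => //; rewrite inE vs orbT.
- by right; exists u => //; rewrite inE eqxx.
- by left; exact: star_root.
- rewrite inE => /predU1P[->|vs]; first by right.
  by move=> zv; left; apply/IH; right; exists v.
Qed.

Lemma star_disjoint y u us :
  all (e y) (u :: us) -> u \notin us -> [disjoint star y us & branch y u].
Proof.
move=> /= /andP[eyu /allP us_e] uus; apply/pred0P=> z /=; apply/negP=> /andP[/starP[->|[v vs zv]] zu].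
  by move: zu; rewrite (negbTE (branch_notin eyu)).
have uv : u != v by apply: contraNneq uus => ->.
by move/pred0P/(_ z): (branch_disjoint eyu (us_e _ vs) uv); rewrite /= zu zv.
Qed.

(** Each branch is glued to the star along the single edge from its root to [y]. With all neighbours
    this counts the subtrees through [y]; with all but the parent it gives the recursion for
    [weight]. *)
Lemma nconn_star y us :
  uniq us -> all (e y) us -> nconn e (star y us) y = \prod_(u <- us) weight y u.
Proof.
elim: us => [|u us IH] /=; first by rewrite /star !big_nil setU0 nconn1.
move=> /andP[uus uus'] us_e; have /andP[eyu us_e'] := us_e.
have dsj := star_disjoint us_e uus.
rewrite star_cons big_cons (nconn_glue e_sym dsj (star_root _ _) (branch_root _ _) eyu).
  by rewrite IH // mulnC.
move=> a b aS bB; rewrite e_sym => /(branch_edge eyu bB)[|-> -> //].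
by apply/negP=> aB; move/pred0P/(_ a): dsj; rewrite /= aS aB.
Qed.

Lemma card_star y us :
  uniq us -> all (e y) us -> #|star y us| = (\sum_(u <- us) #|branch y u|).+1.
Proof.
elim: us => [|u us IH] /=; first by rewrite /star !big_nil setU0 cards1.
move=> /andP[uus uus'] us_e; have /andP[eyu us_e'] := us_e.
have := star_disjoint us_e uus; rewrite -setI_eq0 => /eqP dsj.
by rewrite star_cons big_cons cardsU dsj cards0 subn0 IH // addSn addnC.
Qed.

Definition nbrs y : {set T} := [set u | e y u].

Lemma star_setT y : star y (enum (nbrs y)) = [set: T].
Proof.
apply/setP=> z; rewrite in_setT; apply/starP; have [->|/branch_all[u eyu zu]] := eqVneq z y.
  by left.
by right; exists u => //; rewrite mem_enum inE.
Qed.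

Lemma star_branch x y : e x y -> star y (enum (nbrs y :\ x)) = branch x y.
Proof.
move=> exy; have eyx : e y x by rewrite e_sym.
apply/setP=> z; apply/starP/idP => [[->|[u]]|zB].
- exact: branch_root.
- rewrite mem_enum in_setD1 eq_sym => /andP[xu]; rewrite in_set => eyu.
  exact: (subsetP (branch_sub eyx eyu xu)).
have [->|/branch_all[u eyu zu]] := eqVneq z y; first by left.
right; exists u => //; rewrite mem_enum in_setD1 in_set eyu andbT.
by apply: contraTneq zu => ->; apply/negP; exact: branch_disj zB.
Qed.

Let all_nbrs y (A : {set T}) : A \subset nbrs y -> all (e y) (enum A).
Proof. by move=> /subsetP AN; apply/allP=> u; rewrite mem_enum => /AN; rewrite inE. Qed.

Lemma nsubtreesE y : nsubtrees e y = \prod_(u in nbrs y) weight y u.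
Proof.
by rewrite nsubtrees_nconn -(star_setT y) nconn_star ?enum_uniq ?all_nbrs // big_enum.
Qed.

Lemma weightE x y : e x y -> weight x y = (\prod_(u in nbrs y :\ x) weight y u).+1.
Proof.
move=> exy; rewrite {1}/weight -(star_branch exy) nconn_star ?enum_uniq ?all_nbrs ?subD1set //.
by rewrite big_enum.
Qed.

Lemma card_treeE y : #|T| = (\sum_(u in nbrs y) #|branch y u|).+1.
Proof.
by rewrite -cardsT -(star_setT y) card_star ?enum_uniq ?all_nbrs // big_enum.
Qed.

Lemma card_branchE x y : e x y -> #|branch x y| = (\sum_(u in nbrs y :\ x) #|branch y u|).+1.
Proof.
move=> exy; rewrite -{1}(star_branch exy) card_star ?enum_uniq ?all_nbrs ?subD1set //.
by rewrite big_enum.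
Qed.

Lemma card_branchD x y : e x y -> #|branch x y| + #|branch y x| = #|T|.
Proof. by move=> exy; rewrite (branchC exy) cardsC. Qed.

End Tree.

(** * Arithmetic of caterpillar weights *)

(* The weight of a caterpillar branch with [k] internal vertices; it solves
   [c 0 = 2] and [c k.+1 = (2 * c k).+1]. *)
Definition cat_weight k := (3 * 2 ^ k).-1.

Lemma cat_weightS k : cat_weight k.+1 = (2 * cat_weight k).+1.
Proof. by rewrite /cat_weight expnS; have := expn_gt0 2 k; lia. Qed.

(** The value [cat_weight i * cat_weight j + 1] exceeds [cat_weight (i + j).+1] by
    [3 * (2 ^ i - 1) * (2 ^ j - 1)], which vanishes exactly when [i] or [j] is zero, the caterpillar
    case. *)
Lemma cat_weight_node i j h1 h2 :
  cat_weight i <= h1 -> cat_weight j <= h2 -> cat_weight (i + j).+1 <= (h1 * h2).+1.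
Proof.
move=> h1i h2j; apply: (@leq_trans (cat_weight i * cat_weight j).+1); last by rewrite ltnS leq_mul.
rewrite /cat_weight expnS expnD.
move: (2 ^ i) (2 ^ j) (expn_gt0 2 i) (expn_gt0 2 j) => [|a] [|b] //= _ _; nia.
Qed.

Lemma mul_predE A B C D E :
    0 < A -> 0 < B -> 0 < C -> 0 < D -> A * B = C * D -> C + D = A + B + E ->
  A.-1 * B.-1 = C.-1 * D.-1 + E.
Proof. by case: A B C D => [|A] [|B] [|C] [|D] //=; rewrite !mulSn !mulnS; lia. Qed.

(** Log-concavity with its exact defect. The products of the leading terms [3 * 2 ^ k] agree on both
    sides, so [mul_predE] reduces the comparison to their sums. *)
Lemma cat_weight_mulE c s t :
  cat_weight (c + s) * cat_weight (c + t) =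
  cat_weight c * cat_weight (c + s + t) + 3 * (2 ^ c * (2 ^ s).-1 * (2 ^ t).-1).
Proof.
apply: mul_predE; rewrite ?muln_gt0 ?expn_gt0 // !expnD; first by ring.
move: (2 ^ s) (2 ^ t) (expn_gt0 2 s) (expn_gt0 2 t) => [|y] [|z] //= _ _; ring.
Qed.

Lemma cat_weight_spread a b c d :
  a + b = c + d -> c <= a -> c <= b ->
  cat_weight c * cat_weight d <= cat_weight a * cat_weight b.
Proof.
move=> E ca cb; have -> : d = c + (a - c) + (b - c) by lia.
by rewrite -{2}(subnKC ca) -{2}(subnKC cb) cat_weight_mulE leq_addr.
Qed.

Lemma cat_weight_spread_lt a b c d :
  a + b = c + d -> c < a -> c < b ->
  cat_weight c * cat_weight d < cat_weight a * cat_weight b.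
Proof.
move=> E ca cb; have -> : d = c + (a - c) + (b - c) by lia.
rewrite -{2}(subnKC (ltnW ca)) -{2}(subnKC (ltnW cb)) cat_weight_mulE -[ltnLHS]addn0 ltn_add2l.
have pw n : 0 < n -> 0 < (2 ^ n).-1 by case: n => // n _; rewrite expnS; have := expn_gt0 2 n; lia.
by rewrite !muln_gt0 expn_gt0 !pw ?subn_gt0.
Qed.

(** The number of subtrees through a middle spine vertex of a caterpillar with [2 * m + 4] vertices:
    two halves of the spine, and a pendant leaf contributing the factor 2. *)
Definition cat_core m := 2 * (cat_weight m./2 * cat_weight (uphalf m)).

Lemma cat_core_le m k1 k2 k3 :
    k1 + k2 + k3 = m -> k1 <= uphalf m -> k2 <= uphalf m -> k3 <= uphalf m ->
  cat_core m <= cat_weight k1 * cat_weight k2 * cat_weight k3.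
Proof.
move=> E; have {E} : k1 + k2 + k3 = m./2 + uphalf m by lia.
rewrite /cat_core -[2]/(cat_weight 0); move: m./2 (uphalf m) => p q E q1 q2 q3.
(* With 2 read as [cat_weight 0], the target triple is [(0, p, q)], reached by two spreads. The
   first spreads [k2, k3] until one entry is 0, or, if their sum exceeds [q], until one entry is
   [q]; the second spreads the other entry together with [k1]. *)
rewrite -mulnA; have [kq|qk] := leqP (k2 + k3) q.
  apply: (@leq_trans (cat_weight k1 * (cat_weight 0 * cat_weight (k2 + k3)))).
    by rewrite [leqRHS]mulnCA leq_mul2l cat_weight_spread ?orbT //; lia.
  by rewrite leq_mul2l cat_weight_spread ?orbT.
apply: (@leq_trans (cat_weight k1 * (cat_weight (k2 + k3 - q) * cat_weight q))).
  by rewrite !mulnA leq_mul2r cat_weight_spread ?orbT //; lia.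
by rewrite leq_mul2l cat_weight_spread ?orbT //; lia.
Qed.

(** * Binary trees: branch bounds, centroid and core vertices *)

Section BinaryTree.
Variables (T : finType) (e : rel T).
Hypothesis e_bin : binary_tree e.
Implicit Types x y u v w : T.

Let e_tree : is_tree [set: T] e. Proof. by case: e_bin. Qed.
Let e_sym : symmetric e. Proof. by case: e_tree => _ []. Qed.

Lemma leafP w : reflect (exists u, nbrs e w = [set u]) (w \in leaves e).
Proof. by rewrite inE; apply: cards1P. Qed.

Lemma leaf_nbr w u : w \in leaves e -> e w u -> nbrs e w = [set u].
Proof.
case/leafP=> v E ewu; rewrite E; congr [set _]; apply/esym/set1P.
by rewrite -E inE.
Qed.

Lemma card_nbrs y : y \notin leaves e -> #|nbrs e y| = 3.
Proof. by case: e_bin => _; apply. Qed.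

Lemma branch_leaf x y :
  e x y -> y \in leaves e -> weight e x y = 2 /\ #|branch e x y| = 1.
Proof.
move=> exy yl; have eyx : e y x by rewrite e_sym.
by rewrite weightE // card_branchE // (leaf_nbr yl eyx) setDv !big_set0.
Qed.

Lemma branch_node x y a b :
    e x y -> nbrs e y = [set x; a; b] -> uniq [:: x; a; b] ->
  weight e x y = (weight e y a * weight e y b).+1 /\
  #|branch e x y| = (#|branch e y a| + #|branch e y b|).+1.
Proof.
move=> exy ny; rewrite /= !inE negb_or => /and3P[/andP[xa xb] ab _].
have E : nbrs e y :\ x = a |: [set b].
  rewrite ny; apply/setP=> z; rewrite !inE; have [->|] //= := eqVneq z x.
  by rewrite (negbTE xa) (negbTE xb).
by rewrite weightE // card_branchE // E !big_setU1 ?inE // !big_set1.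
Qed.

Lemma node_nbrs x y :
  e x y -> y \notin leaves e ->
  exists a b, nbrs e y = [set x; a; b] /\ uniq [:: x; a; b].
Proof.
move=> exy /card_nbrs yN; have xN : x \in nbrs e y by rewrite inE e_sym.
move: yN; rewrite (cardsD1 x) xN => -[] /eqP/cards2P[a [b [ab E]]].
exists a, b; rewrite -(setD1K xN) E setUA; split=> //=.
have : x \notin nbrs e y :\ x by rewrite !inE eqxx.
by rewrite E !inE ab => ->.
Qed.

Lemma node_total y a b c :
    nbrs e y = [set a; b; c] -> uniq [:: a; b; c] ->
  nsubtrees e y = weight e y a * weight e y b * weight e y c /\
  #|T| = (#|branch e y a| + #|branch e y b| + #|branch e y c|).+1.
Proof.
move=> ny; rewrite /= !inE negb_or => /and3P[/andP[ab ac] bc _].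
rewrite nsubtreesE // (card_treeE e_tree y) ny -setUA !big_setU1 ?inE ?negb_or ?ab ?ac //.
by rewrite !big_set1 /= !mulnA !addnA.
Qed.

(** If [P] is the product of the weights at [u] over its neighbours other than [w], then [w] lies in
    [P + 1] subtrees, while [u] lies in [2 * P], the leaf [w] having weight 2 there. *)
Lemma nsubtrees_leaf w u :
  w \in leaves e -> e w u -> (nsubtrees e w).*2 = (nsubtrees e u).+2.
Proof.
move=> wl ewu; rewrite (nsubtreesE e_tree w) (leaf_nbr wl ewu) big_set1.
have euw : e u w by rewrite e_sym.
rewrite (nsubtreesE e_tree u) (big_setD1 w) /=; last by rewrite in_set.
by have [-> _] := branch_leaf euw wl; rewrite (weightE e_tree ewu) doubleS mul2n.
Qed.

Lemma branch_bound x y : e x y ->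
  exists k, #|branch e x y| = k.*2.+1 /\ cat_weight k <= weight e x y.
Proof.
have [N] := ubnP #|branch e x y|; elim: N x y => // N IH x y le exy.
have [yl|yl] := boolP (y \in leaves e).
  by exists 0; have [-> ->] := branch_leaf exy yl.
have [a [b [ny ub]]] := node_nbrs exy yl.
have [wE cE] := branch_node exy ny ub.
have [ea eb] : e y a /\ e y b.
  have nE z : e y z = (z \in nbrs e y) by rewrite inE.
  by rewrite !nE ny !inE !eqxx !orbT.
have [|i [ci wi]] := IH y a _ ea; first by lia.
have [|j [cj wj]] := IH y b _ eb; first by lia.
by exists (i + j).+1; rewrite cE wE cat_weight_node //; split=> //; lia.
Qed.

Lemma vertex_nbr x : exists y, e x y.
Proof.
have : nbrs e x != set0.
  rewrite -card_gt0; have [/leafP[u ->]|/card_nbrs->//] := boolP (x \in leaves e).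
  by rewrite cards1.
by case/set0Pn=> y; rewrite inE; exists y.
Qed.

(* Walk towards the heavier side: among the branches holding at least half of
   the vertices, the root of a smallest one is a centroid. *)
Lemma centroid_exists : 2 < #|T| ->
  exists2 y, y \notin leaves e & forall u, e y u -> #|branch e y u|.*2 <= #|T|.
Proof.
have [n nE] : exists n, #|T| = n by exists #|T|.
rewrite nE => n2; pose P := [pred p : T * T | e p.1 p.2 && (n <= #|branch e p.1 p.2|.*2)].
have [p0 Pp0] : exists p, P p.
  have /card_gt0P[x _] : 0 < #|T| by rewrite nE; lia.
  (* Of the two sides of any edge, one holds at least half of the vertices. *)
  have [y exy] := vertex_nbr x; have := card_branchD e_tree exy; rewrite nE.
  have [le _|lt sumE] := leqP n #|branch e x y|.*2; first by exists (x, y); rewrite /= exy le.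
  by exists (y, x); rewrite /= e_sym exy /=; lia.
case: (arg_minnP (fun p => #|branch e p.1 p.2|) Pp0) => -[x y] /= /andP[exy le] min.
have yl : y \notin leaves e.
  by apply/negP=> /(branch_leaf exy)[_ c1]; rewrite c1 in le; lia.
exists y => // u eyu; rewrite leqNgt; apply/negP => lt.
have {min} := min (y, u); rewrite /= eyu ltnW // => /(_ isT).
(* If [u] is [x], the two sides of one edge would together exceed [n] vertices. Otherwise
   [branch y u] is a proper part of [branch x y], against minimality. *)
have [ux|ux] := eqVneq u x.
  by move: lt; rewrite ux; have := card_branchD e_tree exy; rewrite nE; lia.
have eyx : e y x by rewrite e_sym.
rewrite (card_branchE e_tree exy) (big_setD1 u) /=; last by rewrite !inE ux eyu.
by lia.
Qed.

Lemma nsubtrees_max_ge m : #|T| = m.*2 + 4 -> exists y, cat_core m <= nsubtrees e y.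
Proof.
move=> nE; have [|y yl cen] := centroid_exists; first by lia.
have [x eyx] := vertex_nbr y; have exy : e x y by rewrite e_sym.
have [a [b [ny ub]]] := node_nbrs exy yl.
have [F c] := node_total ny ub; exists y; rewrite F.
have nb z : z \in [set x; a; b] -> e y z by rewrite -ny inE.
have := cen a; have := cen b; have := cen x.
have [k1 [c1 w1]] := branch_bound eyx.
have ea : e y a by rewrite nb // !inE eqxx orbT.
have eb : e y b by rewrite nb // !inE eqxx orbT.
have [k2 [c2 w2]] := branch_bound ea.
have [k3 [c3 w3]] := branch_bound eb.
move=> /(_ eyx) l1 /(_ eb) l3 /(_ ea) l2.
(* Counting vertices gives [k1 + k2 + k3 = m]; the centroid bound [4 * ki + 2 <= 2 * m + 4] gives
   [ki <= uphalf m]. *)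
apply: (@leq_trans (cat_weight k1 * cat_weight k2 * cat_weight k3)).
  by apply: cat_core_le; lia.
by rewrite !leq_mul.
Qed.

Lemma core_max v u : v \in core e -> nsubtrees e u <= nsubtrees e v.
Proof. by rewrite inE => /forallP. Qed.

Lemma core_ge m v : #|T| = m.*2 + 4 -> v \in core e -> cat_core m <= nsubtrees e v.
Proof. by move=> /nsubtrees_max_ge[y le] vc; apply: leq_trans le (core_max _ vc). Qed.

(** For a leaf in the core, [nsubtrees_leaf] and maximality would bound its count by 2, whereas
    [cat_core m] is at least 8. *)
Lemma core_not_leaf m v : #|T| = m.*2 + 4 -> v \in core e -> v \notin leaves e.
Proof.
move=> nE vc; apply/negP=> vl; have [u evu] := vertex_nbr v.
have := nsubtrees_leaf vl evu; have := core_max u vc; have := core_ge nE vc.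
have c2 k : 2 <= cat_weight k by rewrite /cat_weight; have := expn_gt0 2 k; lia.
have := leq_mul (c2 m./2) (c2 (uphalf m)); rewrite /cat_core; lia.
Qed.

End BinaryTree.

(** * Subtree counts along a caterpillar *)

Section Caterpillar.
Variables (T : finType) (e : rel T).
Hypothesis e_bin : binary_tree e.
Implicit Types (x y u v w : T) (p s : seq T).

Let e_tree : is_tree [set: T] e. Proof. by case: e_bin. Qed.
Let e_sym : symmetric e. Proof. by case: e_tree => _ []. Qed.

Lemma simple_path_inner_node x0 p i :
  simple_path e p -> i.+2 < size p -> nth x0 p i.+1 \notin leaves e.
Proof.
case/andP=> up /(sortedP x0) sp ip; apply/negP=> /leafP[u nE].
have /set1P iE : nth x0 p i \in [set u] by rewrite -nE in_set e_sym sp // ltnW.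
have /set1P : nth x0 p i.+2 \in [set u] by rewrite -nE in_set sp.
by rewrite -iE => /eqP; rewrite nth_uniq ?(ltnW (ltnW ip)) // => /eqP; lia.
Qed.

(** Removing both ends of a simple path leaves distinct non-leaf vertices. *)
Lemma simple_path_size s p :
  (forall x, (x \in s) = (x \notin leaves e)) -> simple_path e p -> size p <= size s + 2.
Proof.
move=> sE sp; have [|p3] := leqP (size p) 2; first by lia.
have [x0 _] : exists x0, x0 \in p by case: p p3 {sp} => // x0 p; exists x0; rewrite inE eqxx.
pose q := take (size p - 2) (behead p).
have qsz : size q = size p - 2 by rewrite size_takel // size_behead; lia.
suff : size q <= size s by lia.
apply: uniq_leq_size.
  by rewrite take_uniq // (subseq_uniq (s2 := p)) //; [case: (p) => // a r; exact: subseq_cons|case/andP: sp].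
move=> z /(nthP x0)[i]; rewrite qsz => iq <-.
by rewrite nth_take // nth_behead sE simple_path_inner_node //; lia.
Qed.

(** The spine prolonged by a leaf at each end. Every inner vertex then has the same shape, two path
    neighbours and a pendant leaf, and the weight recursion along the path starts at a leaf. *)
Definition backbone x0 p : Prop :=
  [/\ simple_path e p,
      nth x0 p 0 \in leaves e,
      nth x0 p (size p).-1 \in leaves e
    & forall i, i.+2 < size p -> exists w,
        [/\ w \in leaves e,
            nbrs e (nth x0 p i.+1) = [set nth x0 p i; nth x0 p i.+2; w]
          & uniq [:: nth x0 p i; nth x0 p i.+2; w]]].

Lemma backbone_rev x0 p : backbone x0 p -> backbone x0 (rev p).
Proof.
case=> /andP[up /(sortedP x0) sp] l0 l1 nb.
have [p0|p_gt0] := posnP (size p); first by move: p0 up sp l0 l1 nb => /size0nil->.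
have nr i : i < size p -> nth x0 (rev p) i = nth x0 p (size p - i.+1) by exact: nth_rev.
split.
- rewrite /simple_path rev_uniq up /=; apply/(sortedP x0) => i; rewrite size_rev => ip.
  rewrite e_sym !nr // ?(ltnW ip) //.
  by rewrite (_ : size p - i.+1 = (size p - i.+2).+1) ?sp //; lia.
- by rewrite nr // subn1.
- by rewrite size_rev nr ?prednK // subnn.
- move=> i; rewrite size_rev => ip.
  have [|w [wl nE uw]] := nb (size p - i.+3); first by lia.
  exists w; rewrite !nr //; try lia.
  rewrite (_ : size p - i.+2 = (size p - i.+3).+1); last by lia.
  rewrite (_ : size p - i.+1 = (size p - i.+3).+2); last by lia.
  split=> //; first by rewrite nE [X in X :|: _]setUC.
  by move: uw; rewrite /= !inE !negb_or eq_sym => /and3P[/andP[-> ->] -> _].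
Qed.

(** Each step along the path multiplies the weight by 2, for the pendant leaf, and adds one for the
    empty choice: this is [cat_weightS]. Branches in the other direction come from
    [backbone_rev]. *)
Lemma backbone_weight x0 p i : backbone x0 p -> i.+1 < size p ->
  weight e (nth x0 p i.+1) (nth x0 p i) = cat_weight i /\
  #|branch e (nth x0 p i.+1) (nth x0 p i)| = i.*2.+1.
Proof.
case=> /andP[up /(sortedP x0) sp] l0 _ nb.
elim: i => [|i IH] ip; first by apply: branch_leaf; rewrite // e_sym sp.
have [wi ci] := IH (ltnW ip).
have [w [wl nE uw]] := nb i ip.
have ew : e (nth x0 p i.+1) w.
  have : w \in nbrs e (nth x0 p i.+1) by rewrite nE !inE eqxx orbT.
  by rewrite in_set.
have [|||-> ->] := @branch_node _ _ e_bin (nth x0 p i.+2) (nth x0 p i.+1) (nth x0 p i) w.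
- by rewrite e_sym sp.
- by rewrite nE [X in X :|: _]setUC.
- by move: uw; rewrite /= !inE !negb_or eq_sym => /and3P[/andP[-> ->] -> _].
have [-> ->] := branch_leaf e_bin ew wl; rewrite wi ci cat_weightS mulnC; split=> //; lia.
Qed.

Lemma backbone_total x0 p i : backbone x0 p -> i.+2 < size p ->
  nsubtrees e (nth x0 p i.+1) = 2 * (cat_weight i * cat_weight (size p - i.+3)) /\
  #|T| = (size p - 3).*2 + 4.
Proof.
move=> bb ip; have [_ _ _ nb] := bb.
have [w [wl nE uw]] := nb i ip.
have ew : e (nth x0 p i.+1) w.
  have : w \in nbrs e (nth x0 p i.+1) by rewrite nE !inE eqxx orbT.
  by rewrite in_set.
have [-> ->] := node_total e_bin nE uw.
have [-> ->] := branch_leaf e_bin ew wl.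
have [-> ->] := backbone_weight bb (ltnW ip).
have [|] := @backbone_weight x0 (rev p) (size p - i.+3) (backbone_rev bb); first by rewrite size_rev; lia.
rewrite !nth_rev; try lia.
rewrite (_ : size p - (size p - i.+3).+2 = i.+1); last by lia.
rewrite (_ : size p - (size p - i.+3).+1 = i.+2); last by lia.
by move=> -> ->; split; lia.
Qed.

Lemma caterpillar_backbone x0 s :
    s != [::] -> uniq s -> (forall x, (x \in s) = (x \notin leaves e)) ->
    {in s &, forall x y, e x y =
       (index y s == (index x s).+1) || (index x s == (index y s).+1)} ->
  exists a b, backbone x0 (a :: rcons s b).
Proof.
move=> s0 us sE sadj.
have s_gt0 : 0 < size s by case: (s) s0.
have adj i j : i < size s -> j < size s ->
    e (nth x0 s i) (nth x0 s j) = (j == i.+1) || (i == j.+1).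
  by move=> il jl; rewrite sadj ?mem_nth // !index_uniq.
(* A vertex with at most one spine neighbour has at least two leaves among its three neighbours. *)
have end_leaves i j : i < size s -> (forall k, k < size s -> e (nth x0 s i) (nth x0 s k) -> k = j) ->
    2 <= #|nbrs e (nth x0 s i) :&: leaves e|.
  move=> il only; have : nth x0 s i \notin leaves e by rewrite -sE mem_nth.
  move/(card_nbrs e_bin); rewrite -(cardsID (leaves e)).
  suff : #|nbrs e (nth x0 s i) :\: leaves e| <= 1 by lia.
  rewrite -(cards1 (nth x0 s j)) subset_leq_card //; apply/subsetP=> z.
  rewrite in_setD -sE in_set in_set1 => /andP[/(nthP x0)[k kl <-] ez].
  by rewrite (only k).
have [a] : exists a, a \in nbrs e (nth x0 s 0) :&: leaves e.
  apply/card_gt0P; apply: leq_trans (end_leaves 0 1 s_gt0 _) => // k kl.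
  by rewrite adj // orbF => /eqP.
rewrite in_setI in_set => /andP[ea al].
(* Excluding [a] matters when the spine is a single vertex, from which both end leaves hang. *)
have [b] : exists b, b \in (nbrs e (nth x0 s (size s).-1) :&: leaves e) :\ a.
  apply/card_gt0P.
  have : 2 <= #|nbrs e (nth x0 s (size s).-1) :&: leaves e|.
    apply: (end_leaves _ (size s).-2) => [|k kl]; first by lia.
    by rewrite adj //; lia.
  by rewrite (cardsD1 a); lia.
rewrite in_setD1 in_setI in_set => /and3P[ba eb bl].
exists a, b; set p := a :: rcons s b.
have psz : size p = (size s).+2 by rewrite /= size_rcons.
have np i : i < size s -> nth x0 p i.+1 = nth x0 s i by move=> il; rewrite /= nth_rcons il.
have nl : nth x0 p (size s).+1 = b by rewrite /= nth_rcons ltnn eqxx.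
have as_ : a \notin s by rewrite sE al.
have bs_ : b \notin s by rewrite sE bl.
have up : uniq p.
  by rewrite /= rcons_uniq mem_rcons inE negb_or eq_sym ba as_ bs_ us.
have sp i : i.+1 < size p -> e (nth x0 p i) (nth x0 p i.+1).
  rewrite psz ltnS; case: i => [_|i]; first by rewrite np // e_sym.
  rewrite ltnS leq_eqVlt => /orP[/eqP iE|il].
    rewrite iE nl -iE np; last by lia.
    by move: eb; rewrite -iE.
  by rewrite !np ?adj ?eqxx //; lia.
split=> //.
- by rewrite /simple_path up; apply/(sortedP x0).
- by rewrite psz nl.
move=> i ip; set y := nth x0 p i.+1.
have il : i < size s by rewrite psz in ip; lia.
have yE : y = nth x0 s i by rewrite /y np.
have eyi : e (nth x0 p i) y by rewrite /y sp //; lia.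
have ydeg : y \notin leaves e by rewrite yE -sE mem_nth.
have [c [d [nE ucd]]] := node_nbrs e_bin eyi ydeg.
have ne2 : nth x0 p i.+2 != nth x0 p i by rewrite nth_uniq ?(ltnW (ltnW ip)) //; apply/eqP; lia.
have [w [nE2 uw]] : exists w, nbrs e y = [set nth x0 p i; nth x0 p i.+2; w] /\
     uniq [:: nth x0 p i; nth x0 p i.+2; w].
  have : nth x0 p i.+2 \in [set nth x0 p i; c; d] by rewrite -nE in_set sp.
  rewrite !inE (negbTE ne2) /= => /orP[]/eqP ->; first by exists d.
  exists c; rewrite nE setUAC; split=> //.
  by move: ucd; rewrite /= !inE !negb_or (eq_sym d) => /and3P[/andP[-> ->] -> _].
(* A non-leaf third neighbour would be adjacent to [y] on the spine, hence equal to one of its two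
   path neighbours. *)
exists w; split=> //; apply: contraT; rewrite -sE => /(nthP x0)[k kl kw].
have : w \in nbrs e y by rewrite nE2 !inE eqxx orbT.
rewrite in_set yE -kw adj //; move: uw; rewrite /= !inE !negb_or.
rewrite -kw => /and3P[/andP[_ n1] n2 _] /orP[]/eqP kE.
  by move: n2; rewrite -[nth x0 s k]np // kE eqxx.
by move: n1; rewrite -[nth x0 s k]np // -kE eqxx.
Qed.


Lemma caterpillar_core m v :
    binary_caterpillar e -> #|T| = m.*2 + 4 -> v \in core e ->
  [/\ in_middle e v, exists w, w \in leaves e /\ e v w & nsubtrees e v = cat_core m].
Proof.
move=> [_ [s [us sE sadj]]] nE vc; have vl := core_not_leaf e_bin nE vc.
have vs : v \in s by rewrite sE.
have s0 : s != [::] by case: (s) vs.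
have [a [b bb]] := caterpillar_backbone v s0 us sE sadj.
set p := a :: rcons s b in bb.
have psz : size p = (size s).+2 by rewrite /= size_rcons.
pose i := index v s; have il : i < size s by rewrite index_mem.
have vE : v = nth v p i.+1 by rewrite /= nth_rcons il nth_index.
have ip : i.+2 < size p by rewrite psz.
have [F nE'] := backbone_total bb ip; rewrite -vE in F.
have mE : m = i + (size p - i.+3) by lia.
have [sp _ _ nb] := bb; have [up _] := andP sp.
move: F (core_ge e_bin nE vc); set j := size p - i.+3 => F.
(* If [v] were off the middle, strict log-concavity would put its count below [cat_core m], against
   [core_ge]. So [i] and [j] are the two halves of [m]. *)
have [im|im] := ltnP i m./2.
  rewrite F /cat_core leq_mul2l /= leqNgt cat_weight_spread_lt //; lia.
have [jm|jm] := ltnP j m./2.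
  rewrite F /cat_core leq_mul2l /= leqNgt (mulnC (cat_weight i)) cat_weight_spread_lt //; lia.
move=> _.
have ij : (i == m./2) && (j == uphalf m) || (i == uphalf m) && (j == m./2) by lia.
split.
- exists p; split=> //.
  + by move=> p' sp'; rewrite psz -addn2 (simple_path_size sE).
  + by rewrite vE mem_nth // ltnW.
  + rewrite {1 2}vE index_uniq ?(ltnW ip) //; lia.
- have [w [wl nbE _]] := nb i ip; exists w; split=> //.
  have : w \in nbrs e (nth v p i.+1) by rewrite nbE !inE eqxx orbT.
  by rewrite in_set -vE.
- by rewrite F; congr (2 * _); case/orP: ij => /andP[/eqP-> /eqP->] //; rewrite mulnC.
Qed.

End Caterpillar.

Lemma even_cases n : 2 <= n -> ~~ odd n -> n = 2 \/ exists m, n = m.*2 + 4.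
Proof.
move=> n2 ne; have [->|n3] := eqVneq n 2; first by left.
right; exists (n./2 - 2); lia.
Qed.

(** * The closed formula as a function of [cat_core] *)

Section Rationals.
Import GRing.Theory Num.Theory.
Local Open Scope ring_scope.

Lemma pow2E n a d (z : int) : (0 < d)%N -> n%:Z - a%:Z = z * d%:Z -> pow2 n a d = 2 ^ z.
Proof. by move=> d0; rewrite /pow2 => ->; rewrite mulzK //; lia. Qed.

Lemma cat_weightR k : (cat_weight k)%:R = 3 * 2 ^+ k - 1 :> rat.
Proof.
have -> : 3 * 2 ^+ k = (3 * 2 ^ k)%N%:R :> rat by rewrite natrM natrX.
by rewrite /cat_weight -subn1 natrB // muln_gt0 expn_gt0.
Qed.

(** The exponents reach [-2] here, yet numerator and denominator both evaluate to 1. *)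
Lemma min_ratio2 : min_ratio 2 = 1.
Proof. by []. Qed.

Lemma min_ratioE m : min_ratio (m.*2 + 4) = 2 * (cat_core m)%:R / ((cat_core m)%:R + 2).
Proof.
have two_neq0 : (2 : rat) != 0 by [].
(* Both [2 * cat_core m] and [cat_core m + 2] are 4 times the corresponding part of the stated
   fraction. *)
have frac (a b c d : rat) : c = a * 4 -> d = b * 4 -> a / b = c / d.
  by move=> -> ->; rewrite -mulf_div divff // mulr1.
rewrite /min_ratio; case: ifPn => m4.
  have [t ->] : exists t, m = t.*2 by exists m./2; lia.
  have -> : cat_core t.*2 = (2 * (cat_weight t * cat_weight t))%N.
    by rewrite /cat_core doubleK uphalf_double.
  rewrite (@pow2E _ _ _ (t%:Z + t%:Z)) //; last by lia.
  rewrite (@pow2E _ 0%N _ (t%:Z + 1)) //; last by lia.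
  rewrite (@pow2E _ _ _ (t%:Z + t%:Z - 1)) //; last by lia.
  rewrite (@pow2E _ _ _ t%:Z) //; last by lia.
  rewrite !natrM !cat_weightR !expfzDr // exprN1 expr1z -!exprnP.
  by move: (2 ^+ t) => x; apply: frac; field.
have [t ->] : exists t, m = t.*2.+1 by exists m./2; lia.
have -> : cat_core t.*2.+1 = (2 * (cat_weight t * cat_weight t.+1))%N.
  by rewrite /cat_core /= uphalf_double doubleK.
rewrite (@pow2E _ 4 _ (t%:Z + t%:Z + 1)) //; last by lia.
rewrite (@pow2E _ 2 _ (t%:Z + 1)) //; last by lia.
rewrite (@pow2E _ 6 4 t%:Z) //; last by lia.
rewrite (@pow2E _ 6 2 (t%:Z + t%:Z)) //; last by lia.
rewrite (@pow2E _ 10 4 (t%:Z - 1)) //; last by lia.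
rewrite !natrM !cat_weightR exprS !expfzDr // exprN1 expr1z -!exprnP.
by move: (2 ^+ t) => x; apply: frac; field.
Qed.

(** The function [2 * x / (x + 2)] equals [2 - 4 / (x + 2)]. *)
Lemma ratio_mono (M a : nat) : (M <= a)%N ->
  2 * M%:R / (M%:R + 2) <= 2 * a%:R / (a%:R + 2) :> rat.
Proof.
rewrite -(ler_nat rat) => Ma.
have p (k : nat) : 0 < k%:R + 2 :> rat by rewrite ltr_wpDl.
rewrite ler_pdivrMr // mulrAC ler_pdivlMr //.
have : 0 <= M%:R :> rat by [].
nra.
Qed.
End Rationals.

(** * Existence of caterpillars, from a parent function *)

Section ParentTree.
Variables (n : nat) (par : nat -> nat).
Hypothesis par_lt : forall x, 0 < x -> par x < x.

Definition parent_rel : rel 'I_n.+1 :=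
  [rel x y : 'I_n.+1 | (0 < x) && (y == par x :> nat) || (0 < y) && (x == par y :> nat)].

Lemma parent_rel_le x y : parent_rel x y -> y <= x -> y = par x :> nat.
Proof.
case/orP=> /andP[x0 /eqP//]; have := par_lt x0; lia.
Qed.

(** Following parents leads every vertex to 0. On a cycle of length at least 3, both neighbours of
    the largest vertex would be its parent, although they are distinct. *)
Lemma parent_rel_tree : is_tree [set: 'I_n.+1] parent_rel.
Proof.
have sym : symmetric parent_rel by move=> x y; rewrite /parent_rel /= orbC.
split=> //.
- by apply/set0Pn; exists ord0; rewrite inE.
- split=> // x; apply/negP=> /orP[]/andP[/par_lt + /eqP]; lia.
- have to0 x : connect parent_rel x ord0.
    have [k] := ubnP (x : nat); elim: k x => // k IH x xk.
    have [x0|x0] := posnP (x : nat); first by rewrite (_ : x = ord0) //; exact: val_inj.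
    have xlt := par_lt x0; have px : par x < n.+1 by have := ltn_ord x; lia.
    apply: (@connect_trans _ _ (Ordinal px)); last by apply: IH => /=; lia.
    by apply: connect1; rewrite /parent_rel /= x0 eqxx.
  move=> x y _ _; apply: connect_trans (to0 x) _.
  by rewrite (sym_connect_sym sym) to0.
- move=> p cp; rewrite leqNgt; apply/negP=> p3.
  have [z0 z0p] : exists z, z \in p by case: p p3 {cp} => // z p; exists z; rewrite inE eqxx.
  case: (arg_maxnP (P := fun x => x \in p) (fun x : 'I_n.+1 => x : nat) z0p) => z zp max.
  have [i q rE] := rot_to zp.
  move: cp; rewrite -(rot_ucycle i) rE => /andP[].
  have qp u : u \in q -> u <= z.
    by move=> uq; apply: max; rewrite -(mem_rot i) rE inE uq orbT.
  have : size q >= 2 by move: p3; rewrite -(size_rot i) rE.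
  case: q qp {rE} => [|a q] //= qp q1; rewrite rcons_path => /and3P[eza _ ebz].
  have la : last a q \in q by case: q q1 {qp ebz} => //= c q _; rewrite mem_last.
  have aE := parent_rel_le eza (qp a (mem_head _ _)).
  have bE : last a q = par z :> nat.
    by apply: parent_rel_le; [rewrite sym|apply: qp; rewrite inE la orbT].
  case/and3P=> _ + _; rewrite (_ : a = last a q) ?la //.
  by apply: val_inj; rewrite /= aE bE.
Qed.

End ParentTree.

(* Spine vertices are the odd numbers except the last one; the even number above a
   spine vertex is the leaf hanging from it. *)
Definition cat_parent x := if odd x then x.-2 else x.-1.

Lemma caterpillar_exists m :
  exists (T : finType) (e : rel T), binary_caterpillar e /\ #|T| = m.*2.+2.
Proof.
pose e := @parent_rel m.*2.+1 cat_parent.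
have par_lt x : 0 < x -> cat_parent x < x by rewrite /cat_parent; case: ifP; lia.
have e_tree : is_tree [set: 'I_m.*2.+2] e := parent_rel_tree _ par_lt.
have eE x y : e x y = (0 < x) && (y == cat_parent x :> nat) || (0 < y) && (x == cat_parent y :> nat) by [].
have deg3 (x : 'I_m.*2.+2) : odd x -> x < m.*2 -> deg e x = 3.
  move=> ox xm; have [l1 l2] : x.+1 < m.*2.+2 /\ x.+2 < m.*2.+2 by lia.
  (* For [x = 1] the truncated [x.-2] is 0: vertex 0 is the leaf at the start of the spine. *)
  have l0 : x.-2 < m.*2.+2 by lia.
  rewrite /deg; suff -> : [set y | e x y] = [set Ordinal l0; Ordinal l1; Ordinal l2].
    by rewrite -setUA cardsU1 cards2 !inE -!val_eqE /=; lia.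
  apply/setP=> y; rewrite !inE eE -!val_eqE /= /cat_parent; have := ltn_ord y.
  case: ifP; case: ifP; lia.
have spineP (x : 'I_m.*2.+2) : odd x && (x < m.*2) = (x \notin leaves e).
  have [/andP[ox xm]|xn] := boolP (odd x && (x < m.*2)); first by rewrite inE deg3.
  apply/esym/negbTE; rewrite negbK inE /deg; apply/cards1P.
  have [x0|x0] := posnP (x : nat).
    have l1 : 1 < m.*2.+2 by lia.
    exists (Ordinal l1); apply/setP=> y; rewrite !inE eE -!val_eqE /= /cat_parent x0.
    case: ifP; lia.
  have px : cat_parent x < m.*2.+2 by have := par_lt _ x0; have := ltn_ord x; lia.
  exists (Ordinal px); apply/setP=> y; rewrite !inE eE -!val_eqE /= /cat_parent.
  have := ltn_ord y; have := ltn_ord x; case: ifP; case: ifP; lia.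
have e_bin : binary_tree e by split=> // x; rewrite -spineP => /andP[]; exact: deg3.
exists 'I_m.*2.+2, e; split; last exact: card_ord.
split=> //; pose f i : 'I_m.*2.+2 := inord i.*2.+1; exists (mkseq f m).
have fE i : i < m -> f i = i.*2.+1 :> nat by move=> im; rewrite inordK //; lia.
have us : uniq (mkseq f m).
  by apply/mkseq_uniqP => i j im jm /(congr1 val); rewrite /= !fE //; lia.
have sP x : reflect (exists2 i, i < m & x = f i) (x \in mkseq f m).
  apply: (iffP mapP) => -[i im ->]; exists i => //; first by rewrite mem_iota in im.
  by rewrite mem_iota.
have idx i : i < m -> index (f i) (mkseq f m) = i.
  by move=> im; rewrite -{1}(nth_mkseq (f 0) f im) index_uniq // size_mkseq.
split=> //.
  move=> x; rewrite -spineP; apply/sP/andP => [[i im ->]|[ox xm]].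
    by rewrite fE //; lia.
  exists (x : nat)./2; first by lia.
  by apply: val_inj; rewrite /= fE; lia.
move=> x y /sP[i im ->] /sP[j jm ->]; rewrite !idx // eE !fE //= /cat_parent /= !odd_double /=.
lia.
Qed.

(** * From subtree counts to ratios, and the two-vertex tree *)

Section Ratio.
Variables (T : finType) (e : rel T).
Hypothesis e_bin : binary_tree e.
Implicit Types u v w : T.

Let e_sym : symmetric e. Proof. by case: e_bin => -[_ []]. Qed.

Lemma two_vertices_leaf v : #|T| = 2 -> v \in leaves e.
Proof.
move=> T2; apply: contraT => /(card_nbrs e_bin) v3.
by have := max_card (mem (nbrs e v)); rewrite v3 T2.
Qed.

(** Both vertices are leaves, and the two instances of [nsubtrees_leaf] have 2 as only solution. *)
Lemma two_vertices_nsubtrees v : #|T| = 2 -> nsubtrees e v = 2.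
Proof.
move=> T2; have [w evw] := vertex_nbr e_bin v; have ewv : e w v by rewrite e_sym.
have := nsubtrees_leaf e_bin (two_vertices_leaf v T2) evw.
have := nsubtrees_leaf e_bin (two_vertices_leaf w T2) ewv; lia.
Qed.

Lemma two_vertices_middle v : #|T| = 2 -> in_middle e v.
Proof.
move=> T2; have [w evw] := vertex_nbr e_bin v.
have vw : v != w.
  by apply: contraTneq evw => ->; case: e_bin => -[_ [_ ->]].
exists [:: v; w]; split.
- by rewrite /simple_path /= inE vw evw.
- by move=> p /andP[up _]; rewrite -[size [:: v; w]]/2 -T2 -(card_uniqP up) max_card.
- exact: mem_head.
- by rewrite /= eqxx orbT.
Qed.

Import Order.TTheory GRing.Theory Num.Theory.
Local Open Scope ring_scope.

Lemma leaf_nsubtreesR w u : w \in leaves e -> e w u ->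
  (nsubtrees e w)%:R = ((nsubtrees e u)%:R + 2) / 2 :> rat.
Proof.
move=> wl /(nsubtrees_leaf e_bin wl) E; apply: (@mulIf _ 2) => //.
by rewrite divfK // -natrM muln2 E -addn2 natrD.
Qed.

Lemma leaf_ratio v w : w \in leaves e -> e v w ->
  subtree_ratio e v w = 2 * (nsubtrees e v)%:R / ((nsubtrees e v)%:R + 2).
Proof.
move=> wl evw; rewrite /subtree_ratio (leaf_nsubtreesR wl (u := v)) ?(e_sym w) //.
by rewrite invf_div mulrA [_ * 2]mulrC.
Qed.

Lemma core_ratio_ge (M : nat) v w : v \in core e -> w \in leaves e ->
  (M <= nsubtrees e v)%N -> 2 * M%:R / (M%:R + 2) <= subtree_ratio e v w.
Proof.
move=> vc wl Mv; apply: le_trans (ratio_mono Mv) _.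
have [u ewu] := vertex_nbr e_bin w.
rewrite /subtree_ratio (leaf_nsubtreesR wl ewu) invf_div mulrCA mulrA.
(* The neighbour [u] of the leaf has at most the count of the core vertex [v], so replacing it by
   [v] in the denominator can only lower the ratio. *)
have := core_max u vc; rewrite -(ler_nat rat) => uv.
have p (k : nat) : 0 < k%:R + 2 :> rat by rewrite ltr_wpDl.
by rewrite ler_wpM2l ?mulr_ge0 // lef_pV2 ?posrE // lerD2r.
Qed.

End Ratio.

Lemma core_leaf_ratio_ge (T : finType) (e : rel T) v w :
    binary_tree e -> 2 <= #|T| -> ~~ odd #|T| -> v \in core e -> w \in leaves e ->
  (min_ratio #|T| <= subtree_ratio e v w)%R.
Proof.
move=> e_bin n2 ne vc wl; have [T2|[m nE]] := even_cases n2 ne.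
  have := @core_ratio_ge _ _ e_bin 2 v w vc wl.
  by rewrite two_vertices_nsubtrees // T2 min_ratio2; apply.
by rewrite nE min_ratioE; apply: core_ratio_ge => //; exact: core_ge.
Qed.

Lemma caterpillar_core_leaf (T : finType) (e : rel T) v :
    binary_caterpillar e -> 2 <= #|T| -> ~~ odd #|T| -> v \in core e ->
  [/\ in_middle e v,
      exists w : T, w \in leaves e /\ e v w
    & forall w : T, w \in leaves e -> e v w -> subtree_ratio e v w = min_ratio #|T|].
Proof.
move=> e_cat n2 ne vc; have [e_bin _] := e_cat; have [T2|[m nE]] := even_cases n2 ne.
  split; first exact: two_vertices_middle.
    by have [w evw] := vertex_nbr e_bin v; exists w; rewrite two_vertices_leaf.
  by move=> w wl evw; rewrite leaf_ratio // two_vertices_nsubtrees // T2.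
have [mid ex F] := caterpillar_core e_bin e_cat nE vc; split=> // w wl evw.
by rewrite leaf_ratio // F nE min_ratioE.
Qed.

Lemma core_neq0 (T : finType) (e : rel T) (x : T) : exists v, v \in core e.
Proof.
case: (arg_maxnP (P := predT) (nsubtrees e) (erefl : predT x)) => v _ max.
by exists v; rewrite inE; apply/forallP=> u; apply: max.
Qed.

Theorem theorem4p3 (n : nat) (n_ge2 : (2 <= n)%N) (n_even : ~~ odd n) :
  is_min (fun q : rat => exists (T : finType) (e : rel T),
            [/\ binary_tree e, #|T| = n & is_min (core_leaf_ratio e) q])
         (min_ratio n)
  /\ (exists (T : finType) (e : rel T), binary_caterpillar e /\ #|T| = n)
  /\ (forall (T : finType) (e : rel T), binary_caterpillar e -> #|T| = n ->
        forall v : T, v \in core e ->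
          [/\ in_middle e v,
              exists w : T, w \in leaves e /\ e v w
            & forall w : T, w \in leaves e -> e v w ->
                subtree_ratio e v w = min_ratio n]).
Proof.
have cat_ex : exists (T : finType) (e : rel T), binary_caterpillar e /\ #|T| = n.
  have -> : n = (n./2.-1).*2.+2 by lia.
  exact: caterpillar_exists.
split; last first.
  by split=> // T e e_cat nE v vc; rewrite -nE; apply: caterpillar_core_leaf; rewrite ?nE.
have lower (T : finType) (e : rel T) q :
    binary_tree e -> #|T| = n -> core_leaf_ratio e q -> (min_ratio n <= q)%R.
  move=> e_bin nE [v [w [vc wl ->]]].
  by rewrite -nE core_leaf_ratio_ge ?nE.
split; last by move=> q [T [e [e_bin nE [Sq _]]]]; exact: lower Sq.
have [T [e [e_cat nE]]] := cat_ex; have [e_bin _] := e_cat.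
(* Any caterpillar attains the bound: its core is nonempty, and every core vertex has an adjacent
   leaf. *)
exists T, e; split=> //; split; last by move=> q; exact: lower.
have /card_gt0P[x _] : 0 < #|T| by rewrite nE; lia.
have [v vc] := core_neq0 e x.
have [||_ [w [wl evw]] ratioE] := caterpillar_core_leaf e_cat _ _ vc; rewrite ?nE //.
by exists v, w; split=> //; rewrite ratioE // nE.
Qed.
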